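(* Let $\mathcal{A}: V\to V$ be a linear operator on the continuous space $(V,\langle\cdot,\cdot\rangle_{p})$ possessing an adjoint $\mathcal{A}^*$, let $\mathcal{J}_p:\mathbb{R}^n\to V$ be a linear interpolation operator and $\mathcal{S}_p: V\to\mathbb{R}^n$ a linear sampling operator, and let $\mathbf{A}:=\mathcal{S}_p\,\mathcal{A}\,\mathcal{J}_p:\mathbb{R}^n\to\mathbb{R}^n$. Suppose $\mathcal{S}_p$ and $\mathcal{J}_p$ are mutually adjoint, i.e. $\mathcal{S}_p=\mathcal{J}_p^*$. Then for all $\mathbf{f},\mathbf{g}\in\mathbb{R}^n$, with $f:=\mathcal{J}_p\mathbf{f}$ and $g:=\mathcal{J}_p\mathbf{g}$, \[ \langle \mathbf{A}^*\mathbf{f},\mathbf{g}\rangle_{\mathbf{p}}=\langle \mathbf{f},\mathbf{A}\mathbf{g}\rangle_{\mathbf{p}}=\langle f,\mathcal{A}g\rangle_{p}=\langle \mathcal{A}^*f,g\rangle_{p}, \] and the symmetry properties of $\mathcal{A}$ are preserved in $\mathbf{A}$: if $\mathcal{A}$ is symmetric then $\mathbf{A}$ is symmetric, and if $\mathcal{A}$ is skew-symmetric then $\mathbf{A}$ is skew-symmetric. Moreover, if there is $\epsilon>0$ such that $\langle \mathcal{J}_p\mathbf{f},\mathcal{J}_p\mathbf{f}\rangle_{p}\ge\epsilon\,\langle\mathbf{f},\mathbf{f}\rangle_{\mathbf{p}}$ for all $\mathbf{f}\in\mathbb{R}^n$, then $\mathbf{A}$ inherits all positiveness properties of $\mathcal{A}$: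 if $\mathcal{A}$ is nonnegative (respectively positive, positive definite, nonpositive, negative, negative definite), then so is $\mathbf{A}$.
   Context: The continuous space $V$ is a real linear space of functions (fields) on a domain, equipped with an inner product $\langle\cdot,\cdot\rangle_{p}$ (the standard one being $\langle f,g\rangle=\int_D f^Tg\,dD$). The discrete space is $\mathbb{R}^n$ with inner product $\langle \mathbf{x},\mathbf{y}\rangle_{\mathbf{p}}=\mathbf{x}^T\mathbf{Q}\mathbf{y}$, where $\mathbf{Q}$ is a symmetric positive definite $n\times n$ matrix. For an operator $\mathcal{B}:X\to Y$ between real inner product spaces, the adjoint $\mathcal{B}^*:Y\to X$ is the unique operator with $\langle y,\mathcal{B}x\rangle_Y=\langle \mathcal{B}^*y,x\rangle_X$ for all $x\in X$, $y\in Y$. An operator $\mathcal{B}:X\to X$ is symmetric if $\mathcal{B}^*=\mathcal{B}$ and skew-symmetric if $\mathcal{B}^*=-\mathcal{B}$. Adjoints of operators into, out of, or on $\mathbb{R}^n$ and $V$ are taken with respect to $\langle\cdot,\cdot\rangle_{\mathbf{p}}$ and $\langle\cdot,\cdot\rangle_{p}$ respectively. An operator $\mathcal{B}:X\to X$ is: nonnegative if $\langle x,\mathcal{B}x\rangle\ge 0$ for all $x\in X$; positive if $\langle x,\mathcal{B}x\rangle>0$ for all $x\ne 0$ in $X$; positive definite if there exists $\delta>0$ such that $\langle x,\mathcal{B}x\rangle\ge\delta\langle x,x\rangle\ge 0$ for all $x\in X$. It is nonpositive, negative, or negative definite if $-\mathcal{B}$ is nonnegative, positive, or positive definite, respectively.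 *)

(* Defs.v *)
From HB Require Import structures.
From mathcomp Require Import all_boot all_order all_algebra.
From mathcomp Require Import reals.

Set Implicit Arguments.
Unset Strict Implicit.
Unset Printing Implicit Defensive.

Import Order.TTheory GRing.Theory Num.Theory.
Local Open Scope ring_scope.

(* The form is only the inner product of R^n under the hypothesis [spd Q]. *)
Definition dotQ (R : realType) (n : nat) (Q : 'M[R]_n) (x y : 'cV[R]_n) : R :=
  (x^T *m Q *m y) 0 0.

Definition spd (R : realType) (n : nat) (Q : 'M[R]_n) : Prop :=
  Q^T = Q /\ forall x : 'cV[R]_n, x != 0 -> 0 < (x^T *m Q *m x) 0 0.

Section Operators.
Variable R : realType.

(* [is_adjoint ipX ipY B Bs] reads [Bs = B^*].  The adjoint is expressed as a
   relation because it need not exist when X is infinite-dimensional; it is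
   functional for inner products by [is_adjoint_unique]. *)
Definition is_adjoint (X Y : lmodType R)
    (ipX : X -> X -> R) (ipY : Y -> Y -> R) (B : X -> Y) (Bs : Y -> X) : Prop :=
  forall (x : X) (y : Y), ipY y (B x) = ipX (Bs y) x.

Lemma is_adjoint_unique (X Y : lmodType R)
    (ipX : X -> X -> R) (ipY : Y -> Y -> R) (B : X -> Y) (Bs Bs' : Y -> X)
    (ipB : forall u v w, ipX (u - v) w = ipX u w - ipX v w)
    (ip_gt0 : forall u, u != 0 -> 0 < ipX u u) :
  is_adjoint ipX ipY B Bs -> is_adjoint ipX ipY B Bs' -> Bs =1 Bs'.
Proof.
move=> h h' y; apply/eqP; rewrite -subr_eq0; apply/negPn/negP => /ip_gt0.
by rewrite ipB -h -h' subrr ltxx.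
Qed.

Variables (X : lmodType R) (ip : X -> X -> R).
Implicit Type B : X -> X.

Definition sym_op B : Prop := is_adjoint ip ip B B.

Definition skew_op B : Prop := is_adjoint ip ip B (\- B).

Definition nonneg_op B : Prop := forall x, 0 <= ip x (B x).

Definition pos_op B : Prop := forall x, x != 0 -> 0 < ip x (B x).

Definition posdef_op B : Prop :=
  exists2 delta : R, 0 < delta &
    forall x, 0 <= delta * ip x x <= ip x (B x).

Definition nonpos_op B : Prop := nonneg_op (\- B).

Definition neg_op B : Prop := pos_op (\- B).

Definition negdef_op B : Prop := posdef_op (\- B).

End Operators.

(* Main.v *)
Require Import Defs.
From HB Require Import structures.
From mathcomp Require Import all_boot all_order all_algebra.
From mathcomp Require Import reals.

Set Implicit Arguments.
Unset Strict Implicit.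
Unset Printing Implicit Defensive.

Import Order.TTheory GRing.Theory Num.Theory.
Local Open Scope ring_scope.

(** Since [S] is the adjoint of [J], sampling moves across the inner product as interpolation, so
    the bilinear form of [A] is the pullback along [J] of that of [cA]. Adjoints, symmetry and
    skew-symmetry pull back directly. Positiveness concerns only the diagonal of the form:
    nonnegativity just restricts to the range of [J], whereas strictness and definiteness use the
    lower bound on [J]. The three negative properties follow by applying the same [_compression]
    lemmas to the opposite operators. *)

Lemma dotQC (R : realType) (n : nat) (Q : 'M[R]_n) (x y : 'cV[R]_n) :
  Q^T = Q -> dotQ Q x y = dotQ Q y x.
Proof.
(* The form is the sole entry of a 1 by 1 matrix, which transposition leaves unchanged while
   reversing the product. *)
move=> QT; rewrite /dotQ; transitivity ((x^T *m Q *m y)^T 0 0).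
  by rewrite [RHS]mxE.
by rewrite !trmx_mul trmxK QT mulmxA.
Qed.

Lemma dotQNr (R : realType) (n : nat) (Q : 'M[R]_n) (x y : 'cV[R]_n) :
  dotQ Q x (- y) = - dotQ Q x y.
Proof. by rewrite /dotQ mulmxN [LHS]mxE. Qed.

Lemma dotQNl (R : realType) (n : nat) (Q : 'M[R]_n) (x y : 'cV[R]_n) :
  dotQ Q (- x) y = - dotQ Q x y.
Proof. by rewrite /dotQ linearN /= !mulNmx [LHS]mxE. Qed.

Lemma dotQ_ge0 (R : realType) (n : nat) (Q : 'M[R]_n) (x : 'cV[R]_n) :
  spd Q -> 0 <= dotQ Q x x.
Proof.
case=> _ Qpos; have [->|x0] := eqVneq x 0; last exact/ltW/Qpos.
by rewrite /dotQ mulmx0 mxE.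
Qed.

Section Compression.
Variables (R : realType) (V : lmodType R) (ipV : V -> V -> R).
Variables (n : nat) (Q : 'M[R]_n) (J : 'cV[R]_n -> V).
Hypothesis Q_spd : spd Q.
Variables (B : V -> V) (A : 'cV[R]_n -> 'cV[R]_n).
Hypothesis AB : forall f, dotQ Q f (A f) = ipV (J f) (B (J f)).
Variable epsilon : R.
Hypothesis epsilon_gt0 : 0 < epsilon.
Hypothesis J_bounded_below :
  forall f, epsilon * dotQ Q f f <= ipV (J f) (J f).

(** Only the diagonal identity [AB] ties [A] to [B]; neither map is assumed linear, so the pair can
    be instantiated by [cA] and by its pointwise opposite. *)
Lemma nonneg_op_compression : nonneg_op ipV B -> nonneg_op (dotQ Q) A.
Proof. by move=> Bge0 f; rewrite AB. Qed.

(** The lower bound forces [J f] to be nonzero when [f] is: otherwise [epsilon * dotQ Q f f], which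
    is positive, would be at most [ipV 0 0 = 0]. *)
Lemma pos_op_compression :
  ipV 0 0 = 0 -> pos_op ipV B -> pos_op (dotQ Q) A.
Proof.
move=> ip00 Bgt0 f f0; rewrite AB; apply: Bgt0; apply/eqP => Jf0.
have := J_bounded_below f; rewrite Jf0 ip00 leNgt.
by rewrite mulr_gt0//; apply: Q_spd.2.
Qed.

Lemma posdef_op_compression : posdef_op ipV B -> posdef_op (dotQ Q) A.
Proof.
(* The two lower bounds chain: [delta] compares [B] with the norm of [J f], and [epsilon] compares
   that norm with the norm of [f]. *)
case=> delta delta_gt0 Bdelta; exists (delta * epsilon); first exact: mulr_gt0.
move=> f; rewrite AB; have /andP[_ leB] := Bdelta (J f); apply/andP; split.
  by rewrite !mulr_ge0 ?dotQ_ge0// ltW.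
by apply: le_trans leB; rewrite -mulrA ler_wpM2l// ltW.
Qed.

End Compression.

Theorem lemma1 (R : realType)
    (V : lmodType R) (ipV : {dot V for idfun})
    (n : nat) (Q : 'M[R]_n) (Q_spd : spd Q)
    (cA : {linear V -> V}) (cAs : V -> V) (cA_adj : is_adjoint ipV ipV cA cAs)
    (J : {linear 'cV[R]_n -> V}) (S : {linear V -> 'cV[R]_n})
    (JS_adj : is_adjoint (dotQ Q) ipV J S) :
  let A : 'cV[R]_n -> 'cV[R]_n := S \o cA \o J in
  [/\ exists2 As : 'cV[R]_n -> 'cV[R]_n,
        is_adjoint (dotQ Q) (dotQ Q) A As &
        forall f g : 'cV[R]_n,
          [/\ dotQ Q (As f) g = dotQ Q f (A g),
              dotQ Q f (A g) = ipV (J f) (cA (J g)) &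
              ipV (J f) (cA (J g)) = ipV (cAs (J f)) (J g)],
      sym_op ipV cA -> sym_op (dotQ Q) A,
      skew_op ipV cA -> skew_op (dotQ Q) A &
      (exists2 epsilon : R, 0 < epsilon &
         forall f : 'cV[R]_n, ipV (J f) (J f) >= epsilon * dotQ Q f f) ->
      [/\ nonneg_op ipV cA -> nonneg_op (dotQ Q) A,
          pos_op ipV cA -> pos_op (dotQ Q) A &
          posdef_op ipV cA -> posdef_op (dotQ Q) A] /\
      [/\ nonpos_op ipV cA -> nonpos_op (dotQ Q) A,
          neg_op ipV cA -> neg_op (dotQ Q) A &
          negdef_op ipV cA -> negdef_op (dotQ Q) A]].
Proof.
move=> A; have QT := Q_spd.1.
have ipC u v : ipV u v = ipV v u by rewrite hermC /= expr0 mul1r.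
(* [JS_adj] has [S] in the left argument; symmetry of both forms moves it to the right. *)
have dotS f v : dotQ Q f (S v) = ipV (J f) v by rewrite dotQC// -JS_adj ipC.
have dotA f g : dotQ Q f (A g) = ipV (J f) (cA (J g)) by rewrite /A /= dotS.
have dotAA f : dotQ Q f (A f) = ipV (J f) (cA (J f)) by [].
have dotNA f : dotQ Q f ((\- A) f) = ipV (J f) ((\- cA) (J f)).
  by rewrite dotQNr dotA linearNr.
have ip00 : ipV 0 0 = 0 by rewrite linear0r.
split.
(* Taking adjoints reverses the composite [S \o cA \o J] and exchanges [S] with [J], which gives
   this witness. *)
- exists (S \o cAs \o J) => [g f|f g].
    by rewrite dotA cA_adj JS_adj.
  by split; rewrite ?dotA// cA_adj JS_adj.
- by move=> cA_sym g f; rewrite dotA cA_sym ipC -dotA dotQC.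
(* The sign from skewness is pulled out of the left argument on both sides, which reduces the goal
   to the symmetric computation. *)
- by move=> cA_skew g f; rewrite dotA cA_skew dotQNl linearNl dotQC// dotA ipC.
- case=> epsilon epsilon_gt0 J_bounded_below.
  split; split.
  + exact: nonneg_op_compression dotAA.
  + exact: (pos_op_compression Q_spd dotAA epsilon_gt0 J_bounded_below).
  + exact: (posdef_op_compression Q_spd dotAA epsilon_gt0 J_bounded_below).
  + exact: nonneg_op_compression dotNA.
  + exact: (pos_op_compression Q_spd dotNA epsilon_gt0 J_bounded_below).
  + exact: (posdef_op_compression Q_spd dotNA epsilon_gt0 J_bounded_below).
Qed.
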